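(* The regular connective $C(X):=\exists Y.\,\bigl((X\rightarrow(\neg Y\vee\neg\neg Y))\rightarrow X\bigr)$ is not definable by a quantifier-free schema in intuitionistic propositional logic; that is, there is no quantifier-free formula $\Psi(X)$ in the variable $X$ such that both $C(X)\vdash\Psi(X)$ and $\Psi(X)\vdash C(X)$ are derivable.
   Context: Formulas of second-order intuitionistic propositional logic are built from propositional variables and $\bot$ using $\wedge,\vee,\rightarrow$ and the propositional quantifiers $\forall X,\exists X$; $\neg A$ abbreviates $A\rightarrow\bot$. $\Gamma\vdash A$ denotes derivability in the standard Gentzen-style intuitionistic sequent calculus for this language (quantifiers may be instantiated by arbitrary formulas). *)

(* Defs.v *)
From mathcomp Require Import all_boot.

Set Implicit Arguments.
Unset Strict Implicit.
Unset Printing Implicit Defensive.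

(* Variables are de Bruijn indices: [All A] and [Ex A] bind index 0 of [A], so
   the free variable n of [All A] or [Ex A] is written [Var n.+1] in [A]. *)
Inductive form : Type :=
| Var of nat
| Bot
| And of form & form
| Or of form & form
| Imp of form & form
| All of form
| Ex of form.

Definition Neg (A : form) : form := Imp A Bot.

Definition up_ren (r : nat -> nat) (n : nat) : nat :=
  if n is m.+1 then (r m).+1 else 0.

Fixpoint rename (r : nat -> nat) (A : form) : form :=
  match A with
  | Var n => Var (r n)
  | Bot => Bot
  | And B C => And (rename r B) (rename r C)
  | Or B C => Or (rename r B) (rename r C)
  | Imp B C => Imp (rename r B) (rename r C)
  | All B => All (rename (up_ren r) B)
  | Ex B => Ex (rename (up_ren r) B)
  end.

Definition shift (A : form) : form := rename succn A.

Definition up_subst (s : nat -> form) (n : nat) : form :=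
  if n is m.+1 then shift (s m) else Var 0.

(* Simultaneous capture-avoiding substitution. *)
Fixpoint subst (s : nat -> form) (A : form) : form :=
  match A with
  | Var n => s n
  | Bot => Bot
  | And B C => And (subst s B) (subst s C)
  | Or B C => Or (subst s B) (subst s C)
  | Imp B C => Imp (subst s B) (subst s C)
  | All B => All (subst (up_subst s) B)
  | Ex B => Ex (subst (up_subst s) B)
  end.

(* For [A] the body of a quantifier, [inst A B] is A[B/X], X being the variable
   bound by that quantifier. *)
Definition inst (A B : form) : form :=
  subst (fun n => if n is m.+1 then Var m else B) A.

(* In [d_AllR] and [d_ExL] the eigenvariable is index 0 of the premise; shifting
   the side formulas is the condition that it is not free in the conclusion. *)
Inductive derivable : seq form -> form -> Prop :=
| d_ax A : derivable [:: A] A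
| d_cut G D A B :
    derivable G A -> derivable (A :: D) B -> derivable (G ++ D) B
| d_weak G A B : derivable G B -> derivable (A :: G) B
| d_contr G A B : derivable [:: A, A & G] B -> derivable (A :: G) B
| d_exch G D A B C :
    derivable (G ++ [:: A, B & D]) C -> derivable (G ++ [:: B, A & D]) C
| d_BotL A : derivable [:: Bot] A
| d_AndL1 G A B C : derivable (A :: G) C -> derivable (And A B :: G) C
| d_AndL2 G A B C : derivable (B :: G) C -> derivable (And A B :: G) C
| d_AndR G A B : derivable G A -> derivable G B -> derivable G (And A B)
| d_OrL G A B C :
    derivable (A :: G) C -> derivable (B :: G) C -> derivable (Or A B :: G) C
| d_OrR1 G A B : derivable G A -> derivable G (Or A B)
| d_OrR2 G A B : derivable G B -> derivable G (Or A B)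
| d_ImpL G D A B C :
    derivable G A -> derivable (B :: D) C -> derivable (Imp A B :: G ++ D) C
| d_ImpR G A B : derivable (A :: G) B -> derivable G (Imp A B)
| d_AllL G A B C : derivable (inst A B :: G) C -> derivable (All A :: G) C
| d_AllR G A : derivable (map shift G) A -> derivable G (All A)
| d_ExL G A C :
    derivable (A :: map shift G) (shift C) -> derivable (Ex A :: G) C
| d_ExR G A B : derivable G (inst A B) -> derivable G (Ex A).

Fixpoint quantifier_free (A : form) : bool :=
  match A with
  | Var _ | Bot => true
  | And B C | Or B C | Imp B C => quantifier_free B && quantifier_free C
  | All _ | Ex _ => false
  end.

Fixpoint free_in (n : nat) (A : form) : bool :=
  match A with
  | Var m => m == n
  | Bot => false
  | And B C | Or B C | Imp B C => free_in n B || free_in n C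
  | All B | Ex B => free_in n.+1 B
  end.

Definition connC (A : form) : form :=
  let X := shift A in
  let Y := Var 0 in
  Ex (Imp (Imp X (Or (Neg Y) (Neg (Neg Y)))) X).

(* Main.v *)
Require Import Defs.
From mathcomp Require Import all_boot.
From Corelib Require Import Setoid.

Set Implicit Arguments.
Unset Strict Implicit.
Unset Printing Implicit Defensive.

(** Quantifier-free formulas are invariant under p-morphisms of Kripke models,
    and [connC] is not.

    Interpret the second-order language in Kripke models in which the
    propositional quantifiers range over all upward closed sets of worlds; the
    sequent calculus is sound for this reading ([soundness]).  At a world p,
    C(X) asks for an upward closed Y such that every world above p outside X
    sees a world of X at which Y is undecided, that is, at which neither not-Y
    nor not-not-Y holds.  So C(X) detects branching inside X, which a formula
    without quantifiers cannot see, since X looks the same at all worlds of X.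

    Concretely, let the chain have a root outside X and one world above it,
    in X.  A maximal world decides every Y, so C(X) fails at the root
    ([chain_not_connC]).  Let the fork have a root outside X, above it a world
    of X, and above that world two maximal ones, again in X: taking for Y one
    of the maximal worlds makes C(X) true at the root ([fork_connC]).  Collapsing the
    X-part of the fork to a single world is a p-morphism onto the chain, so a
    quantifier-free formula has the same truth value at the two roots
    ([force_pmorphism]) and cannot be equivalent to C(X). *)

(** * Second-order Kripke semantics *)

Record frame := Frame {
  world :> Type;
  le : world -> world -> Prop;
  le_refl : forall p, le p p;
  le_trans : forall q p r, le p q -> le q r -> le p r
}.

Definition upset (F : frame) (P : F -> Prop) : Prop :=
  forall p q, le p q -> P p -> P q.

Definition scons (T : Type) (a : T) (e : nat -> T) (n : nat) : T :=
  if n is m.+1 then e m else a.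

Fixpoint force (F : frame) (e : nat -> F -> Prop) (A : form) (p : F) : Prop :=
  match A with
  | Var n => e n p
  | Bot => False
  | And B C => force e B p /\ force e C p
  | Or B C => force e B p \/ force e C p
  | Imp B C => forall q, le p q -> force e B q -> force e C q
  | All B => forall Y, upset Y -> force (scons Y e) B p
  | Ex B => exists2 Y, upset Y & force (scons Y e) B p
  end.

Fixpoint force_all (F : frame) (e : nat -> F -> Prop) (G : seq form) (p : F) :
    Prop :=
  if G is A :: G' then force e A p /\ force_all e G' p else True.

Lemma upset_scons (F : frame) (Y : F -> Prop) (e : nat -> F -> Prop) :
  upset Y -> (forall n, upset (e n)) -> forall n, upset (scons Y e n).
Proof. by move=> uY ue [|n]; [exact: uY | exact: ue]. Qed.

Lemma force_upset (F : frame) (A : form) (e : nat -> F -> Prop) :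
  (forall n, upset (e n)) -> upset (force e A).
Proof.
elim: A e => [n||B IHB C IHC|B IHB C IHC|B IHB C IHC|B IHB|B IHB] e ue p q pq //=.
- exact: ue.
- by case=> hB hC; split; [apply: IHB pq hB | apply: IHC pq hC].
- by case=> h; [left; apply: IHB pq h | right; apply: IHC pq h].
- by move=> h r qr; apply: h; apply: le_trans qr.
- move=> h Y uY; apply: IHB pq (h Y uY) => //; exact: upset_scons.
- case=> Y uY h; exists Y => //; apply: IHB pq h => //; exact: upset_scons.
Qed.

Lemma force_all_upset (F : frame) (G : seq form) (e : nat -> F -> Prop) :
  (forall n, upset (e n)) -> upset (force_all e G).
Proof.
move=> ue p q pq; elim: G => //= A G IH [hA hG].
by split; [apply: force_upset pq hA | apply: IH].
Qed.

Lemma force_all_cat (F : frame) (e : nat -> F -> Prop) (G D : seq form) (p : F) :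
  force_all e (G ++ D) p <-> force_all e G p /\ force_all e D p.
Proof. elim: G => [|A G IH] /=; tauto. Qed.

(** The second valuation is only required to agree pointwise with the
    reindexed one, so that the induction passes under binders, where [scons]
    and [up_ren] commute pointwise but not definitionally. *)
Lemma force_rename (F : frame) (A : form) (r : nat -> nat)
    (e e' : nat -> F -> Prop) :
  (forall n p, e (r n) p <-> e' n p) ->
  forall p, force e (rename r A) p <-> force e' A p.
Proof.
have up k (d d' : nat -> F -> Prop) Y :
    (forall n p, d (k n) p <-> d' n p) ->
    forall n p, scons Y d (up_ren k n) p <-> scons Y d' n p.
  by move=> dd' [|n] p /=.
elim: A r e e' => [n||B IHB C IHC|B IHB C IHC|B IHB C IHC|B IHB|B IHB] r e e' ee' p //=;
  try by rewrite (IHB r e e') // (IHC r e e').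
- by split=> h q pq /(IHB r e e' ee') hB; apply/(IHC r e e' ee')/h.
- have IH Y := IHB _ _ _ (up _ _ _ Y ee').
  by split=> h Y uY; apply/(IH Y)/h.
- have IH Y := IHB _ _ _ (up _ _ _ Y ee').
  by split=> -[Y uY h]; exists Y => //; apply/(IH Y).
Qed.

Lemma force_shift (F : frame) (A : form) (Y : F -> Prop) (e : nat -> F -> Prop)
    (p : F) : force (scons Y e) (shift A) p <-> force e A p.
Proof. exact: force_rename. Qed.

Lemma force_all_shift (F : frame) (G : seq form) (Y : F -> Prop)
    (e : nat -> F -> Prop) (p : F) :
  force_all (scons Y e) (map shift G) p <-> force_all e G p.
Proof. by elim: G => //= A G IH; rewrite force_shift IH. Qed.

Lemma force_subst (F : frame) (A : form) (s : nat -> form)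
    (e e' : nat -> F -> Prop) :
  (forall n p, force e (s n) p <-> e' n p) ->
  forall p, force e (subst s A) p <-> force e' A p.
Proof.
have up t (d d' : nat -> F -> Prop) Y :
    (forall n p, force d (t n) p <-> d' n p) ->
    forall n p, force (scons Y d) (up_subst t n) p <-> scons Y d' n p.
  by move=> dd' [|n] p //=; rewrite force_shift.
elim: A s e e' => [n||B IHB C IHC|B IHB C IHC|B IHB C IHC|B IHB|B IHB] s e e' ee' p //=;
  try by rewrite (IHB s e e') // (IHC s e e').
- by split=> h q pq /(IHB s e e' ee') hB; apply/(IHC s e e' ee')/h.
- have IH Y := IHB _ _ _ (up _ _ _ Y ee').
  by split=> h Y uY; apply/(IH Y)/h.
- have IH Y := IHB _ _ _ (up _ _ _ Y ee').
  by split=> -[Y uY h]; exists Y => //; apply/(IH Y).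
Qed.

Lemma force_inst (F : frame) (A B : form) (e : nat -> F -> Prop) (p : F) :
  force e (inst A B) p <-> force (scons (force e B) e) A p.
Proof. by apply: force_subst => -[|n]. Qed.

(** The rules [d_AllL] and [d_ExR] instantiate with an arbitrary formula; they
    are sound because the truth set of a formula is itself one of the upward
    closed sets over which the quantifiers range. *)
Lemma soundness (F : frame) (G : seq form) (A : form) :
  derivable G A ->
  forall (e : nat -> F -> Prop), (forall n, upset (e n)) ->
  forall p, force_all e G p -> force e A p.
Proof.
elim=> {G A}.
- by move=> A e ue p [].
- move=> G D A B _ IHA _ IHB e ue p /force_all_cat[hG hD].
  by apply: IHB => //; split=> //; apply: IHA.
- by move=> G A B _ IH e ue p [_ hG]; apply: IH.
- by move=> G A B _ IH e ue p [hA hG]; apply: IH.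
- move=> G D A B C _ IH e ue p /force_all_cat[hG [hB [hA hD]]].
  by apply: IH => //; apply/force_all_cat.
- by move=> A e ue p [].
- by move=> G A B C _ IH e ue p [[hA _] hG]; apply: IH.
- by move=> G A B C _ IH e ue p [[_ hB] hG]; apply: IH.
- by move=> G A B _ IHA _ IHB e ue p hG; split; [apply: IHA | apply: IHB].
- move=> G A B C _ IHA _ IHB e ue p [[hA|hB] hG]; first exact: IHA.
  exact: IHB.
- by move=> G A B _ IH e ue p hG; left; apply: IH.
- by move=> G A B _ IH e ue p hG; right; apply: IH.
- move=> G D A B C _ IHA _ IHC e ue p [hAB /force_all_cat[hG hD]].
  apply: IHC => //; split=> //; apply: hAB; first exact: le_refl.
  exact: IHA.
- move=> G A B _ IH e ue p hG q pq hA; apply: IH => //; split=> //.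
  exact: force_all_upset pq hG.
- move=> G A B C _ IH e ue p [hA hG]; apply: IH => //; split=> //.
  by apply/force_inst/hA; apply: force_upset.
- move=> G A _ IH e ue p hG Y uY; apply: IH; first exact: upset_scons.
  exact/force_all_shift.
- move=> G A C _ IH e ue p [[Y uY hA] hG]; apply/(force_shift C Y).
  by apply: IH; [exact: upset_scons | split=> //; apply/force_all_shift].
- move=> G A B _ IH e ue p hG; exists (force e B); first exact: force_upset.
  exact/force_inst/IH.
Qed.

(** A p-morphism is monotone and lifts every step of the target; these are the
    two directions needed for implication.  Quantifiers are excluded because
    the preimages of upward closed sets need not exhaust those of the source. *)
Lemma force_pmorphism (F F' : frame) (f : F -> F')
    (e : nat -> F -> Prop) (e' : nat -> F' -> Prop) (A : form) :
  (forall p q, le p q -> le (f p) (f q)) ->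
  (forall p q', le (f p) q' -> exists2 q, le p q & f q = q') ->
  (forall n p, e n p <-> e' n (f p)) ->
  quantifier_free A -> forall p, force e A p <-> force e' A (f p).
Proof.
move=> fmono flift ee'.
elim: A => [n||B IHB C IHC|B IHB C IHC|B IHB C IHC|//|//] //= => [||] /andP[qB qC] p;
  try by rewrite IHB // IHC.
split=> h.
- move=> q' /flift[q pq <-] /(IHB qB) hB; exact/(IHC qC)/h.
- by move=> q pq /(IHB qB) hB; apply/(IHC qC)/h => //; apply: fmono.
Qed.

(** * The chain and the fork *)

Lemma chain_le_trans (q p r : bool) : p ==> q -> q ==> r -> p ==> r.
Proof. by case: p q r => [] [] []. Qed.

Definition chain : frame :=
  @Frame bool (fun p q => p ==> q) implybb chain_le_trans.

Lemma chain_not_connC (x : nat) :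
  ~ force (fun _ (p : chain) => p) (connC (Var x)) false.
Proof.
case=> Y uY /= h.
(* Excluded middle for Y at the top world is available because the goal is an
   absurdity. *)
have nnY : ~ ~ (Y true \/ ~ Y true) by tauto.
apply: nnY => dY; suff: false by [].
apply: (h false) => // -[] // _ _; case: dY => dY; [right | left].
- by move=> [] // _ /(_ true isT dY).
- by move=> [].
Qed.

(** [None] is the root, [Some None] the branching world and [Some (Some b)]
    the two maximal worlds. *)
Definition fork_le (p q : option (option bool)) : bool :=
  match p, q with
  | None, _ => true
  | Some None, Some _ => true
  | _, _ => p == q
  end.

Lemma fork_le_refl (p : option (option bool)) : fork_le p p.
Proof. by case: p => [[[]|]|]. Qed.

Lemma fork_le_trans (q p r : option (option bool)) :
  fork_le p q -> fork_le q r -> fork_le p r.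
Proof. by case: p q r => [[[]|]|] [[[]|]|] [[[]|]|]. Qed.

Definition fork : frame :=
  @Frame (option (option bool)) fork_le fork_le_refl fork_le_trans.

Lemma fork_connC (x : nat) :
  force (fun _ (p : fork) => isSome p) (connC (Var x)) None.
Proof.
exists (fun p : fork => p = Some (Some true)).
  by move=> p q pq pE; move: pq; rewrite pE; case: q => [[[]|]|].
move=> [a|] //= _ h.
(* At the branching world, Some (Some true) refutes not-Y and Some (Some false)
   refutes not-not-Y. *)
case: (h (Some None) isT isT) => [nY|nnY].
- by case: (nY (Some (Some true))).
- by case: (nnY (Some (Some false))) => // -[[[]|]|].
Qed.

Lemma fork_to_chain (A : form) (p : fork) :
  quantifier_free A ->
  force (fun _ (q : fork) => isSome q) A p <->
  force (fun _ (q : chain) => q) A (isSome p).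
Proof.
move=> qA; apply: (@force_pmorphism fork chain (fun q => isSome q)) => //.
- by move=> [[[]|]|] [[[]|]|].
- move=> [a|] [] //= _.
  + by exists (Some a); first exact: (fork_le_refl (Some a)).
  + by exists (Some None).
  + by exists None.
Qed.

Theorem corollary5p13 (x : nat) :
  ~ exists Psi : form,
      [/\ quantifier_free Psi,
          forall n : nat, free_in n Psi -> n = x,
          derivable [:: connC (Var x)] Psi
        & derivable [:: Psi] (connC (Var x))].
Proof.
case=> Psi [qf _ CPsi PsiC]; apply: (@chain_not_connC x).
apply: (soundness PsiC); first by move=> _ [] [].
split=> //; apply/(fork_to_chain None qf).
apply: (soundness CPsi); first by move=> _ [[[]|]|] [[[]|]|].
by split=> //; apply: fork_connC.
Qed.
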